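(* Let $G$ be a finite simple graph without isolated vertices, with minimum degree $\delta$ and maximum degree $\Delta$, and let $a \in \mathbb{R}$. Then $$\frac12\, \delta^{a} R_{-a}(G) \le ISD_a(G) \le \frac12\, \Delta^{a} R_{-a}(G), \qquad \text{if } a>0,$$ $$\frac12\, \Delta^{a} R_{-a}(G) \le ISD_a(G) \le \frac12\, \delta^{a} R_{-a}(G), \qquad \text{if } a<0.$$ In each of these four bounds, equality is attained if and only if $G$ is regular.
   Context: Graphs are undirected, finite, nonempty, simple (no loops, no multiple edges), without isolated vertices, and not necessarily connected; so $1\le\delta\le\Delta<n$ where $n=|V(G)|$. $d_u$ denotes the degree of the vertex $u$, and $uv$ denotes the (unordered) edge joining $u$ and $v$; sums over $uv\in E(G)$ run once over each edge. For $a\in\mathbb{R}$ the variable inverse sum deg index is $$ISD_a(G)=\sum_{uv\in E(G)}\frac{1}{d_u^a+d_v^a}.$$ For $b\in\mathbb{R}\setminus\{0\}$ the general Randić index is $$R_b(G)=\sum_{uv\in E(G)}(d_ud_v)^b.$$ A graph is regular if all its vertices have the same degree. *)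

(* Defs.v *)
From HB Require Import structures.
From mathcomp Require Import all_boot all_order all_algebra.
From mathcomp Require Import reals exp.

Set Implicit Arguments.
Unset Strict Implicit.
Unset Printing Implicit Defensive.

Import Order.TTheory GRing.Theory Num.Theory.
Local Open Scope ring_scope.

Record sgraph := SGraph {
  svertex :> finType;
  sedge : rel svertex;
  sedge_sym : symmetric sedge;
  sedge_irrefl : irreflexive sedge }.

Definition deg (G : sgraph) (u : G) : nat := #|[set v | sedge u v]|.

(* The default value of the minimum is harmless: every degree is at most #|G|,
   so for nonempty G this is the smallest degree. *)
Definition mindeg (G : sgraph) : nat := \big[minn/#|G|]_(u : G) deg u.
Definition maxdeg (G : sgraph) : nat := (\max_(u : G) deg u)%N.

Definition no_isolated (G : sgraph) : Prop := forall u : G, exists v, sedge u v.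

Definition regular (G : sgraph) : Prop := forall u v : G, deg u = deg v.

(* An edge is the two-element set of its ends, so that a sum over [edges G]
   runs once over each unordered edge. *)
Definition edges (G : sgraph) : {set {set G}} :=
  [set [set uv.1; uv.2] | uv : G * G & sedge uv.1 uv.2].

(* For A = {u, v} with u != v, the inner sum is d_u^a + d_v^a. *)
Definition ISD (R : realType) (a : R) (G : sgraph) : R :=
  \sum_(A in edges G) (\sum_(u in A) (deg u)%:R `^ a)^-1.

(* For A = {u, v} with u != v, the inner product is d_u * d_v. *)
Definition Randic (R : realType) (b : R) (G : sgraph) : R :=
  \sum_(A in edges G) (\prod_(u in A) (deg u)%:R) `^ b.

(* Main.v *)
Require Import Defs.
From HB Require Import structures.
From mathcomp Require Import all_boot all_order all_algebra.
From mathcomp Require Import reals exp.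
From mathcomp Require Import ring lra.

(** Write w u = d_u ^ a.  As the power function is multiplicative, R_{-a}
    is the sum over the edges uv of 1 / (w u * w v), while ISD_a is the sum of
    1 / (w u + w v).  Hence all four bounds compare the two sums edge by edge,
    and the comparison rests on one identity [inv_add_half_mulV]: for
    positive x, y,
      1 / (x + y) - c / (2 x y) = ((1 - c/x) + (1 - c/y)) / (2 (x + y)).
    Its right-hand side is nonnegative when c is a lower bound of x and y,
    nonpositive when c is an upper bound, and in both cases it vanishes only
    for x = y = c.

    Summing over the edges, equality holds in a bound iff w u = c for every
    end u of an edge, that is, since no vertex is isolated, for every vertex
    ([sum_edges_leif]).  Here c is the a-th power of the minimum or maximum
    degree; which of the two bounds w from below depends on the sign of a.
    The power function is injective on positive numbers when a is nonzero, so
    equality says that all degrees agree with the extreme one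
    ([forall_powR_eq_regular]). *)

Set Implicit Arguments.
Unset Strict Implicit.
Unset Printing Implicit Defensive.

Import Order.TTheory GRing.Theory Num.Theory.
Local Open Scope ring_scope.

(** This form isolates the excess of each of x and y over c, so that both the
    sign of the difference and its vanishing can be read off. *)
Lemma inv_add_half_mulV (F : realFieldType) (x y c : F) : 0 < x -> 0 < y ->
  (x + y)^-1 - 2^-1 * c * (x * y)^-1 =
    ((x - c) / x + (y - c) / y) / (2 * (x + y)).
Proof.
move=> x0 y0; field.
by rewrite !gt_eqF ?addr_gt0.
Qed.

Lemma half_mulV_leif_inv_add (F : realFieldType) (x y c : F) :
  0 < x -> 0 < y -> c <= x -> c <= y ->
  2^-1 * c * (x * y)^-1 <= (x + y)^-1 ?= iff (x == c) && (y == c).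
Proof.
move=> x0 y0 cx cy.
have xy0 : 0 < 2 * (x + y) by rewrite mulr_gt0 ?addr_gt0.
have Dx : 0 <= (x - c) / x by rewrite ler_pdivlMr // mul0r subr_ge0.
have Dy : 0 <= (y - c) / y by rewrite ler_pdivlMr // mul0r subr_ge0.
split.
  by rewrite -subr_ge0 inv_add_half_mulV // ler_pdivlMr // mul0r addr_ge0.
rewrite eq_sym -subr_eq0 inv_add_half_mulV // mulf_eq0 invr_eq0 (gt_eqF xy0).
rewrite orbF paddr_eq0 // !mulf_eq0 !invr_eq0 (gt_eqF x0) (gt_eqF y0) !orbF.
by rewrite !subr_eq0.
Qed.

Lemma inv_add_leif_half_mulV (F : realFieldType) (x y c : F) :
  0 < x -> 0 < y -> x <= c -> y <= c ->
  (x + y)^-1 <= 2^-1 * c * (x * y)^-1 ?= iff (x == c) && (y == c).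
Proof.
move=> x0 y0 xc yc.
have xy0 : 0 < 2 * (x + y) by rewrite mulr_gt0 ?addr_gt0.
have Dx : (x - c) / x <= 0 by rewrite ler_pdivrMr // mul0r subr_le0.
have Dy : (y - c) / y <= 0 by rewrite ler_pdivrMr // mul0r subr_le0.
split.
  by rewrite -subr_le0 inv_add_half_mulV // ler_pdivrMr // mul0r; lra.
rewrite -subr_eq0 inv_add_half_mulV // mulf_eq0 invr_eq0 (gt_eqF xy0).
rewrite orbF naddr_eq0 // !mulf_eq0 !invr_eq0 (gt_eqF x0) (gt_eqF y0) !orbF.
by rewrite !subr_eq0.
Qed.

Lemma edgesP (G : sgraph) (A : {set G}) :
  reflect (exists u v, [/\ sedge u v, u != v & A = [set u; v]])
          (A \in edges G).
Proof.
apply: (iffP imsetP) => [[[u v]]|[u [v [uv _ ->]]]]; last first.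
  by exists (u, v); rewrite // inE.
rewrite inE /= => uv ->; exists u, v; split=> //.
by apply: contraTneq uv => ->; rewrite sedge_irrefl.
Qed.

(** A condition on the ends of every edge is a condition on every vertex
    because each vertex has a neighbour; this is where isolated vertices,
    invisible to sums over edges, must be excluded. *)
Lemma sum_edges_leif (F : realFieldType) (G : sgraph) (f g : {set G} -> F)
    (P : pred G) : no_isolated G ->
  (forall u v, u != v -> f [set u; v] <= g [set u; v] ?= iff P u && P v) ->
  \sum_(A in edges G) f A <= \sum_(A in edges G) g A ?= iff [forall u, P u].
Proof.
move=> niso fg.
have -> : [forall u, P u] =
    [forall (A : {set G} | A \in edges G), [forall u in A, P u]].
  apply/forallP/forall_inP => [PV A _|PE u]; first exact/forall_inP.
  have [v uv] := niso u.
  have EA : [set u; v] \in edges G.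
    by apply/imsetP; exists (u, v); rewrite // inE.
  by have /forall_inP := PE _ EA; apply; rewrite !inE eqxx.
apply: leif_sum => A /edgesP[u [v [_ uv ->]]].
have -> : [forall x in [set u; v], P x] = P u && P v; last exact: fg.
apply/forall_inP/andP => [H|[Hu Hv] x]; first by rewrite !H ?inE ?eqxx ?orbT.
by rewrite !inE => /orP[]/eqP->.
Qed.

Section WeightedEdgeSums.
Variables (F : realFieldType) (G : sgraph) (w : G -> F) (c : F).
Hypotheses (niso : no_isolated G) (w_gt0 : forall u, 0 < w u).

Lemma half_sum_prodV_leif_sum_addV : (forall u, c <= w u) ->
  2^-1 * c * (\sum_(A in edges G) (\prod_(u in A) w u)^-1) <=
  \sum_(A in edges G) (\sum_(u in A) w u)^-1 ?= iff [forall u, w u == c].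
Proof.
move=> cw; rewrite mulr_sumr; apply: sum_edges_leif => // u v uv.
rewrite !big_setU1 ?inE //= !big_set1.
exact: half_mulV_leif_inv_add.
Qed.

Lemma sum_addV_leif_half_sum_prodV : (forall u, w u <= c) ->
  \sum_(A in edges G) (\sum_(u in A) w u)^-1 <=
  2^-1 * c * (\sum_(A in edges G) (\prod_(u in A) w u)^-1)
    ?= iff [forall u, w u == c].
Proof.
move=> wc; rewrite mulr_sumr; apply: sum_edges_leif => // u v uv.
rewrite !big_setU1 ?inE //= !big_set1.
exact: inv_add_leif_half_mulV.
Qed.

End WeightedEdgeSums.

Lemma prod_powR (R : realType) (I : finType) (A : {set I}) (f : I -> R)
    (a : R) : (forall i, 0 <= f i) ->
  (\prod_(i in A) f i) `^ a = \prod_(i in A) f i `^ a.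
Proof.
move=> f0.
(* [powRM] needs the partial products to be nonnegative, so that is carried
   through the induction. *)
suff [] : 0 <= \prod_(i in A) f i /\
    (\prod_(i in A) f i) `^ a = \prod_(i in A) f i `^ a by [].
elim/big_rec2: _ => [|i x y _ [y0 IH]]; first by rewrite powR1.
by rewrite mulr_ge0 // powRM // IH.
Qed.

(** Puts the index in the form of an edge sum of products of the weights
    d_u ^ a, the same weights that ISD_a adds up. *)
Lemma Randic_oppE (R : realType) (G : sgraph) (a : R) :
  Randic (- a) G =
  \sum_(A in edges G) (\prod_(u in A) (deg u)%:R `^ a)^-1.
Proof. by apply: eq_bigr => A _; rewrite powRN prod_powR. Qed.

Lemma deg_gt0 (G : sgraph) (u : G) : no_isolated G -> (0 < deg u)%N.
Proof.
by move=> /(_ u)[v uv]; apply/card_gt0P; exists v; rewrite inE.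
Qed.

Lemma mindeg_le_deg (G : sgraph) (u : G) : (mindeg G <= deg u)%N.
Proof.
rewrite /mindeg; elim: (index_enum G) (mem_index_enum u) => // v s IH.
rewrite inE big_cons geq_min => /orP[/eqP<-|/IH->]; last exact: orbT.
by rewrite leqnn.
Qed.

Lemma deg_le_maxdeg (G : sgraph) (u : G) : (deg u <= maxdeg G)%N.
Proof. exact: (@leq_bigmax _ (@deg G) u). Qed.

(** The bound by the number of vertices accounts for the default value of the
    minimum. *)
Lemma leq_mindeg (G : sgraph) (m : nat) : (m <= #|G|)%N ->
  (forall u : G, (m <= deg u)%N) -> (m <= mindeg G)%N.
Proof.
move=> mG md; rewrite /mindeg; elim/big_ind: _ => // x y mx my.
by rewrite leq_min mx.
Qed.

Lemma regular_mindeg (G : sgraph) (u : G) : regular G -> deg u = mindeg G.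
Proof.
move=> reg; apply/eqP; rewrite eqn_leq mindeg_le_deg andbT.
by apply: leq_mindeg => [|v]; rewrite ?max_card // (reg u v).
Qed.

Lemma regular_maxdeg (G : sgraph) (u : G) : regular G -> deg u = maxdeg G.
Proof.
move=> reg; apply/eqP; rewrite eqn_leq deg_le_maxdeg /=.
by apply/bigmax_leqP => v _; rewrite (reg v u).
Qed.

Section PowersOfPositives.
Variable R : realType.
Implicit Types a x y : R.

Lemma ltr0_ler_powR a x y : a < 0 -> 0 < x -> x <= y -> y `^ a <= x `^ a.
Proof.
move=> a0 x0 xy; have y0 := lt_le_trans x0 xy.
have na0 : 0 <= - a by rewrite oppr_ge0 ltW.
rewrite -[a]opprK; move: (- a) na0 => b b0.
rewrite !powRN lef_pV2 ?posrE ?powR_gt0 //.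
by rewrite ge0_ler_powR ?nnegrE ?(ltW x0) ?(ltW y0).
Qed.

Lemma powR_inj_gt0 a x y : a != 0 -> 0 < x -> 0 < y ->
  x `^ a = y `^ a -> x = y.
Proof.
move=> a0 x0 y0 e; apply: ln_inj; rewrite ?posrE //.
by apply: (mulfI a0); rewrite -!ln_powR e.
Qed.

(** Meant for m the minimum or the maximum degree. *)
Lemma forall_powR_eq_regular (G : sgraph) a (m : nat) :
  no_isolated G -> a != 0 -> (0 < m)%N ->
  (regular G -> forall u : G, deg u = m) ->
  [forall u : G, (deg u)%:R `^ a == m%:R `^ a] <-> regular G.
Proof.
move=> niso a0 m0 regm; split=> [/forallP H|reg]; last first.
  by apply/forallP => u; rewrite regm.
suff degm (u : G) : deg u = m by move=> u v; rewrite !degm.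
apply/eqP; rewrite -(eqr_nat R); apply/eqP.
by apply: (powR_inj_gt0 a0); rewrite ?ltr0n ?deg_gt0 //; apply/eqP.
Qed.

End PowersOfPositives.

Theorem theorem1 (R : realType) (G : sgraph) (hG : (0 < #|G|)%N)
    (hiso : no_isolated G) (a : R) :
  let dBound := 2^-1 * (mindeg G)%:R `^ a * Randic (- a) G in
  let DBound := 2^-1 * (maxdeg G)%:R `^ a * Randic (- a) G in
  (0 < a ->
     [/\ dBound <= ISD a G, ISD a G <= DBound,
         (ISD a G = dBound <-> regular G) & (ISD a G = DBound <-> regular G)]) /\
  (a < 0 ->
     [/\ DBound <= ISD a G, ISD a G <= dBound,
         (ISD a G = DBound <-> regular G) & (ISD a G = dBound <-> regular G)]).
Proof.
move=> dBound DBound; rewrite /dBound /DBound Randic_oppE /ISD.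
have d0 : (0 < mindeg G)%N by apply: leq_mindeg => // u; apply: deg_gt0.
have D0 : (0 < maxdeg G)%N.
  have /card_gt0P[u _] := hG.
  by apply: leq_trans (deg_le_maxdeg u); apply: deg_gt0.
have w0 (u : G) : 0 < (deg u)%:R `^ a :> R by rewrite powR_gt0 // ltr0n deg_gt0.
have regd (an0 : a != 0) := forall_powR_eq_regular hiso an0 d0
  (fun reg u => @regular_mindeg G u reg).
have regD (an0 : a != 0) := forall_powR_eq_regular hiso an0 D0
  (fun reg u => @regular_maxdeg G u reg).
split=> a0.
- have an0 : a != 0 by rewrite gt_eqF.
  have [|dle deq] := half_sum_prodV_leif_sum_addV (c := (mindeg G)%:R `^ a) hiso w0.
    by move=> u; rewrite ge0_ler_powR ?nnegrE ?ler_nat ?mindeg_le_deg ?(ltW a0).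
  have [|Dle Deq] := sum_addV_leif_half_sum_prodV (c := (maxdeg G)%:R `^ a) hiso w0.
    by move=> u; rewrite ge0_ler_powR ?nnegrE ?ler_nat ?deg_le_maxdeg ?(ltW a0).
  split=> //.
    by rewrite -(regd an0) -deq eq_sym; split=> /eqP.
  by rewrite -(regD an0) -Deq; split=> /eqP.
- have an0 : a != 0 by rewrite lt_eqF.
  have [|Dle Deq] := half_sum_prodV_leif_sum_addV (c := (maxdeg G)%:R `^ a) hiso w0.
    by move=> u; apply: ltr0_ler_powR; rewrite ?ltr0n ?ler_nat ?deg_gt0 ?deg_le_maxdeg.
  have [|dle deq] := sum_addV_leif_half_sum_prodV (c := (mindeg G)%:R `^ a) hiso w0.
    by move=> u; apply: ltr0_ler_powR; rewrite ?ltr0n ?ler_nat ?mindeg_le_deg.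
  split=> //.
    by rewrite -(regD an0) -Deq eq_sym; split=> /eqP.
  by rewrite -(regd an0) -deq; split=> /eqP.
Qed.
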